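(* Let $a>0$. The following statements hold. (i) If $0<a\le 2$, then for every integer $k\ge1$, $\gamma_k(a)=\sqrt{a+2(k-1)}$. (ii) If $a>2$, then $\gamma_1(a)=\sqrt a$ and, for every integer $k\ge2$, $$\gamma_k(a)=\max_{0\le t\le1}\Big\{t\,\gamma_{k-1}(a)+\sqrt{(1-t)\big(a(1-t)+4t\big)}\Big\}=\gamma_{k-1}(a)+\frac{2}{\gamma_{k-1}(a)+\sqrt{\gamma_{k-1}(a)^2+4-a}}.$$
   Context: For $a>0$, an integer $m\ge1$, a real symmetric $m\times m$ matrix $B$ and $U\subset[m]=\{1,\dots,m\}$, put $$\mathcal I_{U,a}(B):=\frac1a\sum_{i\in U}B_{ii}^2+\sum_{i<j,\ i,j\in U}B_{ij}^2,$$ $$\mathcal K_m(a):=\{B=B^\top\in\mathbb R^{m\times m}:\ \mathcal I_{U,a}(B)\le|U|\text{ for every }\varnothing\ne U\subset[m]\},$$ and $\gamma_m(a):=\max_{B\in\mathcal K_m(a)}\lambda_{\max}(B)$ (the maximum exists since $\mathcal K_m(a)$ is compact). *)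

(* Defs.v *)
From HB Require Import structures.
From mathcomp Require Import all_boot all_order all_algebra.
From mathcomp Require Import boolp classical_sets reals.

Set Implicit Arguments.
Unset Strict Implicit.
Unset Printing Implicit Defensive.

Import Order.TTheory GRing.Theory Num.Theory.
Local Open Scope classical_set_scope.
Local Open Scope ring_scope.

Definition is_max (R : realType) (A : set R) (x : R) : Prop :=
  A x /\ ubound A x.

(* The greatest element of [A]; unlike [sup A], it has to be attained.  The
   value is 0 when [A] has no greatest element. *)
Definition setmax (R : realType) (A : set R) : R := xget 0 [set x | is_max A x].

Lemma setmaxE (R : realType) (A : set R) (x : R) : is_max A x -> setmax A = x.
Proof.
move=> mx; apply: xget_unique => // y [Ay ubA_y].
by apply/eqP; rewrite eq_le (mx.2 _ Ay) (ubA_y _ mx.1).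
Qed.

Definition lambda_max (R : realType) (m : nat) (B : 'M[R]_m) : R :=
  setmax [set x : R | eigenvalue B x].

Definition calI (R : realType) (m : nat) (U : {set 'I_m}) (a : R)
    (B : 'M[R]_m) : R :=
  a^-1 * (\sum_(i in U) B i i ^+ 2)
  + \sum_(i in U) \sum_(j in U | (i < j)%N) B i j ^+ 2.

Definition calK (R : realType) (m : nat) (a : R) : set 'M[R]_m :=
  [set B | B = B^T /\
    forall U : {set 'I_m}, U != finset.set0 -> calI U a B <= #|U|%:R].

(* Meaningful for [0 < m]. *)
Definition gamma (R : realType) (m : nat) (a : R) : R :=
  setmax [set lambda_max B | B in @calK R m a].

(* Main.v *)
Require Import Defs.
From HB Require Import structures.
From mathcomp Require Import all_boot all_order all_algebra.
From mathcomp Require Import boolp classical_sets reals set_interval.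
From mathcomp Require Import topology normedtype derive realfun.
From mathcomp Require Import ring lra.

Set Implicit Arguments.
Unset Strict Implicit.
Unset Printing Implicit Defensive.

Import Order.TTheory GRing.Theory Num.Theory numFieldNormedType.Exports.
Local Open Scope classical_set_scope.
Local Open Scope ring_scope.

(** Fix [x] and write [p i = x i ^+ 2].  Entry by entry, the quadratic form of
    [B] at [x] is at most half the sum over ordered pairs of
    [Num.sqrt (mass a B u v * cap a p u v)], where [mass] depends on [B] only
    and [cap] on [x] only; in these terms [calK] says that the mass of
    [U * U] is at most [2 * #|U|] for every [U].

    If [a <= 2], the constraint for the full set is enough: by the
    Cauchy-Schwarz inequality the form is at most the root of [k] times half
    the total capacity, which is largest when [p] is uniform; a matrix that is
    constant on the diagonal and constant off it attains this bound and obeys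
    all the other constraints.

    If [a > 2], the maximum over [B] for a given [x] has a dual description.
    Split each capacity [cap u v] between the ends [u] and [v]; the load of
    [v] is the sum of its shares, and the form is bounded by the maximum over
    all splittings of [root_sum z], the sum of the square roots of the loads
    ([qform_le_root_sum]).  Next let [p] vary as well, with a fixed sum, and
    take a joint maximizer ([exists_maximizer]).
    Total load is [2 * (\sum_v p v) ^+ 2 + (a - 2) * \sum_v p v ^+ 2], so
    it grows when weight moves from a vertex [j] to one, [i], which is at least
    as heavy; if [i] has a share in the edge [ij], this share can be spent to
    let both [i] and [j] profit and no other load change ([tilt]).  Hence at a
    maximizer every edge belongs to its lighter end ([maximizer_owner]), and
    the lightest vertex [v] owns all the edges at it.  Its load is
    [a * q ^+ 2 + 4 * (q * (s - q))] with [q = p v] and [s] the sum of [p],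
    and deleting [v] leaves the same problem with one vertex less.  This is
    the recursion of the theorem ([root_sum_le_gamma_rec]), and the maximum
    over [q] is found by completing a square ([step_upper],
    [step_attained]).  Conversely, giving each edge to its end of larger index
    defines a matrix of [calK] ([exists_matrix]) that attains the bound for
    suitable weights ([exists_weights]).

    Everything is done with quadratic forms: a vector at which the form meets
    its upper bound is an eigenvector ([gamma_eq]). *)

(** * Splitting edge capacities between their ends *)

(** Normalised so that four times the square of [B u v * (x u * x v)] is
    [mass a B u v * cap a p u v] for [p i = x i ^+ 2], on the diagonal too. *)
Definition cap (R : realType) (a : R) (T : finType) (p : T -> R)
    (u v : T) : R :=
  (if u == v then 2 * a else 4) * (p u * p v).

Definition load (R : realType) (T : finType) (z : T -> T -> R) (v : T) : R :=
  \sum_u z u v.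

Definition root_sum (R : realType) (T : finType) (z : T -> T -> R) : R :=
  \sum_v Num.sqrt (load z v).

(** [z u v] is the share of [v] in the edge [uv].  A loop counts twice in the
    symmetric equation, whence [z v v = a * p v ^+ 2]. *)
Definition splits (R : realType) (a : R) (T : finType) (p : T -> R)
    (z : T -> T -> R) : Prop :=
  (forall u v, 0 <= z u v) /\ (forall u v, z u v + z v u = cap a p u v).

(** The upper bounds [b] serve two purposes: [b = p] with [s] its sum freezes
    [p], while [b] supported on a set confines [p] to this set. *)
Definition feasible (R : realType) (a : R) (T : finType) (b : T -> R) (s : R)
    (p : T -> R) (z : T -> T -> R) : Prop :=
  [/\ forall i, 0 <= p i <= b i, \sum_i p i = s & splits a p z].

Definition maximizer (R : realType) (a : R) (T : finType) (b : T -> R) (s : R)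
    (p : T -> R) (z : T -> T -> R) : Prop :=
  feasible a b s p z /\
  forall p' z', feasible a b s p' z' -> root_sum z' <= root_sum z.

Lemma continuous_sumf (R : realType) (E : topologicalType) (I : Type)
    (r : seq I) (P : pred I) (f : I -> E -> R) :
  (forall i, continuous (f i)) ->
  continuous (fun x => \sum_(i <- r | P i) f i x).
Proof.
move=> cf; elim: r => [|i r IHr].
  under eq_fun do rewrite big_nil.
  exact: cst_continuous.
under eq_fun do rewrite big_cons.
case: (P i) => // x.
apply: (@continuousD R R E (f i)); [exact: cf | exact: IHr].
Qed.

(** The feasible pairs form a closed subset of a product of segments, since
    each share of an edge is at most the capacity computed from [b]. *)
Lemma exists_maximizer (R : realType) (a : R) (T : finType) (b : T -> R)
    (s : R) :
  0 <= a ->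
  (exists p z, feasible a b s p z) ->
  exists p z, maximizer a b s p z.
Proof.
move=> a_ge0 [p0 [z0 F0]].
pose I := (T + T * T)%type.
pose E := prod_topology (fun _ : I => R).
pose pr (f : E) : T -> R := fun i => f (inl i).
pose zr (f : E) : T -> T -> R := fun u v => f (inr (u, v)).
pose mk (p : T -> R) (z : T -> T -> R) : E :=
  fun i => match i with inl i => p i | inr w => z w.1 w.2 end.
have cpr i : continuous (fun f : E => pr f i).
  exact: (@proj_continuous I (fun _ => R) (inl i)).
have czr u v : continuous (fun f : E => zr f u v).
  exact: (@proj_continuous I (fun _ => R) (inr (u, v))).
pose B (i : I) : set R :=
  match i with
  | inl i => `[0, b i]%classic
  | inr w => `[0, cap a b w.1 w.2]%classic
  end.
pose K : set E := [set f | forall i, B i (f i)].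
have compactK : compact K.
  apply: (@tychonoff I (fun _ => R) B) => -[i|w]; exact: segment_compact.
pose C1 : set E := [set f | \sum_i pr f i = s].
pose C2 (w : T * T) : set E :=
  [set f | zr f w.1 w.2 + zr f w.2 w.1 - cap a (pr f) w.1 w.2 = 0].
have closedC1 : closed C1.
  rewrite (_ : C1 = (fun f : E => \sum_i pr f i) @^-1` [set s]) //.
  apply: closed_comp; last exact: closed_eq.
  by move=> x _; apply: continuous_sumf.
have closedC2 w : closed (C2 w).
  pose g (f : E) := zr f w.1 w.2 + zr f w.2 w.1 - cap a (pr f) w.1 w.2.
  rewrite (_ : C2 w = g @^-1` [set 0]) //.
  apply: closed_comp; last exact: closed_eq.
  move=> x _.
  apply: (@continuousB R R E (fun f => zr f w.1 w.2 + zr f w.2 w.1)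
                       (fun f => cap a (pr f) w.1 w.2)).
    by apply: (@continuousD R R E (fun f => zr f w.1 w.2)
                            (fun f => zr f w.2 w.1)); exact: czr.
  apply: (@continuousM R E (fun _ => _) (fun f => pr f w.1 * pr f w.2)).
    exact: cst_continuous.
  by apply: (@continuousM R E (pr^~ w.1) (pr^~ w.2)); exact: cpr.
pose A := K `&` (C1 `&` \bigcap_w C2 w).
have compactA : compact A.
  apply: compact_closedI compactK _; apply: closedI => //.
  exact: closed_bigI.
have AP f : A f <-> feasible a b s (pr f) (zr f).
  split=> [[Kf [C1f C2f]]|[pf C1f [zf0 zfD]]].
    split=> // [i|]; first by have := Kf (inl i); rewrite /= in_itv.
    split=> u v; first by have := Kf (inr (u, v)); rewrite /= in_itv => /andP[].
    by apply/eqP; rewrite -subr_eq0; apply/eqP; apply: (C2f (u, v)).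
  split; last by split=> // -[u v] _; rewrite /C2 /= zfD subrr.
  move=> [i|[u v]]; rewrite /= in_itv /=; first exact: pf.
  rewrite zf0 (@le_trans _ _ (cap a (pr f) u v)) //.
    by rewrite -zfD lerDl.
  have /andP[pu0 pub] := pf u; have /andP[pv0 pvb] := pf v.
  by apply: ler_wpM2l; [case: ifP => _; lra | exact: ler_pM].
have mkA p z : feasible a b s p z -> A (mk p z) by move=> F; apply/AP.
have [||f fA fmax] :=
    @compact_EVT_max E R (fun f => root_sum (zr f)) A _ compactA.
- by exists (mk p0 z0); exact: mkA.
- apply: continuous_subspaceT; apply: continuous_sumf => v x.
  apply: (@continuous_comp E R R (fun f => load (zr f) v) (@Num.sqrt R)).
    by apply: continuous_sumf.
  exact: sqrt_continuous.
exists (pr f), (zr f); split; first by apply/AP; exact: set_mem fA.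
by move=> p' z' F; apply: (fmax (mk p' z')); exact/mem_set/mkA.
Qed.

(** * Optimal splittings for given weights *)

Lemma sqrt_le_sqr (R : rcfType) (x y : R) :
  0 <= y -> x <= y ^+ 2 -> Num.sqrt x <= y.
Proof.
by move=> y0 xy; rewrite -(ger0_norm y0) -sqrtr_sqr; apply: ler_wsqrtr.
Qed.

(** After squaring, only the products count: making two numbers closer with
    the same sum increases their product. *)
Lemma sqrtD_lt_balance (R : rcfType) (x y e : R) :
  0 <= x -> 0 < e -> x + e <= y - e ->
  Num.sqrt x + Num.sqrt y < Num.sqrt (x + e) + Num.sqrt (y - e).
Proof.
move=> x0 e0 xy.
have y0 : 0 <= y by lra.
have xe0 : 0 <= x + e by lra.
have ye0 : 0 <= y - e by lra.
rewrite -(@ltr_pXn2r _ 2) ?nnegrE ?addr_ge0 ?sqrtr_ge0 //.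
rewrite !sqrrD !sqr_sqrtr // -!sqrtrM //.
have : Num.sqrt (x * y) < Num.sqrt ((x + e) * (y - e)).
  rewrite ltr_sqrt; first by nra.
  by apply: mulr_gt0; lra.
lra.
Qed.

Lemma splits_diag (R : realType) (a : R) (T : finType) (p : T -> R)
    (z : T -> T -> R) (v : T) : splits a p z -> z v v = a * p v ^+ 2.
Proof. by move=> [_ /(_ v v)]; rewrite /cap eqxx => h; lra. Qed.

Lemma load_ge0 (R : realType) (T : finType) (z : T -> T -> R) (v : T) :
  (forall u v, 0 <= z u v) -> 0 <= load z v.
Proof. by move=> z0; apply: sumr_ge0. Qed.

Lemma root_sum_lt (R : realType) (T : finType) (z z' : T -> T -> R) (i j : T) :
  i != j ->
  (forall k, k != i -> k != j -> load z' k = load z k) ->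
  Num.sqrt (load z i) + Num.sqrt (load z j)
    < Num.sqrt (load z' i) + Num.sqrt (load z' j) ->
  root_sum z < root_sum z'.
Proof.
move=> ij zz' lt_ij.
have ji : j != i by rewrite eq_sym.
rewrite /root_sum (bigD1 i) //= (bigD1 j) //= [ltRHS](bigD1 i) //=.
rewrite [X in _ < _ + X](bigD1 j) //= !addrA ltr_leD //.
by apply: ler_sum => k /andP[ki kj]; rewrite zz'.
Qed.

(** The elementary move on splittings: one unit of the edge [xy] passes from
    [x] to [y]. *)
Definition transfer (R : realType) (T : finType) (x y u v : T) : R :=
  ((u == x) && (v == y))%:R - ((u == y) && (v == x))%:R.

Lemma sum_transfer (R : realType) (T : finType) (x y v : T) :
  \sum_u transfer R x y u v = (v == y)%:R - (v == x)%:R.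
Proof.
rewrite /transfer sumrB; congr (_ - _).
  by rewrite (bigD1 x) //= eqxx big1 ?addr0 // => u /negPf ->.
by rewrite (bigD1 y) //= eqxx big1 ?addr0 // => u /negPf ->.
Qed.

Lemma transfer_antisym (R : realType) (T : finType) (x y u v : T) :
  transfer R x y u v + transfer R x y v u = 0.
Proof. by rewrite /transfer [(v == x) && _]andbC [(v == y) && _]andbC; ring. Qed.

Lemma load_shift (R : realType) (T : finType) (z e : T -> T -> R) (v : T) :
  load (fun u v => z u v + e u v) v = load z v + \sum_u e u v.
Proof. exact: big_split. Qed.

(** Otherwise part of the edge could be moved from [j] to the less loaded [i],
    and concavity of the square root would increase the sum. *)
Lemma maximizer_load_le (R : realType) (a : R) (T : finType) (b : T -> R)
    (s : R) (p : T -> R) (z : T -> T -> R) (i j : T) :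
  maximizer a b s p z -> 0 < z i j -> load z j <= load z i.
Proof.
move=> [[pb ps [z0 zD]] zmax] zij.
have [->//|ij] := eqVneq i j.
have ji : j != i by rewrite eq_sym.
rewrite leNgt; apply/negP => lt_ij.
pose e := Num.min (z i j) ((load z j - load z i) / 2).
have e0 : 0 < e by rewrite /e lt_min zij /= divr_gt0 // subr_gt0.
have e1 : e <= z i j by rewrite /e ge_min lexx.
have e2 : e <= (load z j - load z i) / 2 by rewrite /e ge_min lexx orbT.
pose z' u v := z u v + e * transfer R j i u v.
have loadz' v : load z' v = load z v + e * ((v == i)%:R - (v == j)%:R).
  by rewrite load_shift -mulr_sumr sum_transfer.
have /zmax : feasible a b s p z'.
  split=> //; split=> u v; last first.
    have := zD u v; have := transfer_antisym R j i u v; rewrite /z' => h <-.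
    by rewrite -[RHS]addr0 -[X in _ = _ + X](mulr0 e) -h; ring.
  rewrite /z' /transfer.
  have [/andP[/eqP -> /eqP ->]|_] := boolP ((u == i) && (v == j)).
    by rewrite (negPf ij) /=; lra.
  by rewrite subr0 addr_ge0 // mulr_ge0 // ltW.
apply/negP; rewrite -ltNge; apply: (root_sum_lt ij) => [k /negPf ki /negPf kj|].
  by rewrite loadz' ki kj subrr mulr0 addr0.
rewrite !loadz' !eqxx (negPf ij) (negPf ji) subr0 sub0r mulr1 mulrN1.
by apply: sqrtD_lt_balance; rewrite ?load_ge0 //; lra.
Qed.

(** * Jointly optimal weights and splittings *)

(** Moving weight [e] from [j] to the heavier [i] increases the total load, as
    [a > 2].  An edge [uj] loses [4 * (e * p u)], which is taken from an end
    that owns enough of it; the edge [ui] gains the same amount, and [u] takes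
    back there what it lost, so the load of [u] is unchanged.  On balance this
    favours [i] over [j]; passing a part of the edge [ij] from [i] to [j]
    restores the balance, and both gain. *)
Lemma tilt (R : realType) (a : R) (T : finType) (p : T -> R)
    (z : T -> T -> R) (i j : T) :
  2 < a -> (forall k, 0 <= p k) -> splits a p z ->
  i != j -> 0 < p j -> p j <= p i -> 0 < z j i ->
  exists p' z', [/\ forall k, 0 <= p' k,
    \sum_k p' k = \sum_k p k /\ forall k, k != i -> k != j -> p' k = p k,
    splits a p' z',
    forall k, k != i -> k != j -> load z' k = load z k
    & load z i < load z' i /\ load z j < load z' j].
Proof.
move=> a2 p0 zS ij pj0 le_ji zji.
have pi0 : 0 < p i by apply: lt_le_trans le_ji.
have zdiag u := splits_diag u zS.
have [z0 zD] := zS.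
set s := \sum_k p k.
have ji : j != i by rewrite eq_sym.
have sE : s = p i + (p j + \sum_(u | (u != i) && (u != j)) p u).
  by rewrite /s (bigD1 i) //= (bigD1 j).
set q := \sum_(u | (u != i) && (u != j)) p u in sE.
have q0 : 0 <= q by apply: sumr_ge0.
(* [e * K] bounds the loss of [i] in the edge [ij], and [p j / 2] keeps the
   other shares nonnegative. *)
pose K := (6 * a + 8) * s.
have K0 : 0 < K by rewrite mulr_gt0; lra.
pose e := Num.min (p j / 2) (z j i / K).
have e0 : 0 < e by rewrite /e lt_min !divr_gt0.
have e1 : e <= p j / 2 by rewrite /e ge_min lexx.
have e2 : e * K <= z j i by rewrite -ler_pdivlMr // /e ge_min lexx orbT.
pose p' u := if u == i then p i + e else if u == j then p j - e else p u.
(* At least one end of [uj] holds half of it, namely [2 * p j * p u], and this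
   end bears the loss of that edge; [r u] is the part of the gain of the edge
   [ui] that goes to [i], and [u] takes the rest. *)
pose r u : R := if 2 * (p j * p u) <= z u j then 4 * (e * p u) else 0.
pose rho := \sum_(u | (u != i) && (u != j)) r u.
have r0 u : 0 <= r u.
  by rewrite /r; case: ifP => // _; rewrite !mulr_ge0 // ltW.
have r4 u : r u <= 4 * (e * p u).
  by rewrite /r; case: ifP => // _; rewrite !mulr_ge0 // ltW.
have rho0 : 0 <= rho by apply: sumr_ge0.
have rho4 : rho <= 4 * (e * q).
  by rewrite /rho /q !mulr_sumr; apply: ler_sum.
pose al := a * (2 * (p i * e) + e ^+ 2).
pose be := a * (e ^+ 2 - 2 * (p j * e)).
(* Half of the growth of the total [2 * s ^+ 2 + (a - 2) * \sum_u p u ^+ 2]. *)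
pose de := (a - 2) * (e * (p i - p j) + e ^+ 2).
have de0 : 0 < de.
  by apply: mulr_gt0; [lra|rewrite ltr_wpDl ?exprn_gt0 // mulr_ge0 //; lra].
(* The shares of [ij] are chosen to give both ends the same gain [de]. *)
pose x := de - al - rho.
pose y := de - be + rho.
pose d u v :=
  if u == i then
    if v == i then al else if v == j then y else 4 * (e * p v) - r v
  else if u == j then
    if v == i then x else if v == j then be else r v - 4 * (e * p v)
  else if v == i then r u else if v == j then - r u else 0.
pose z' u v := z u v + d u v.
have loadi : load z' i = load z i + de.
  rewrite load_shift; congr (_ + _).
  rewrite (bigD1 i) //= (bigD1 j) //= /d !eqxx (negPf ji) /x.
  rewrite (eq_bigr r); first by rewrite -/rho; ring.
  by move=> u /andP[/negPf -> /negPf ->].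
have loadj : load z' j = load z j + de.
  rewrite load_shift; congr (_ + _).
  rewrite (bigD1 i) //= (bigD1 j) //= /d !eqxx (negPf ji) /y.
  rewrite (eq_bigr (fun u => - r u)).
    by rewrite sumrN -/rho; ring.
  by move=> u /andP[/negPf -> /negPf ->].
have loadu k : k != i -> k != j -> load z' k = load z k.
  move=> /negPf ki /negPf kj; rewrite load_shift -[RHS]addr0; congr (_ + _).
  rewrite (bigD1 i) //= (bigD1 j) //= /d !eqxx (negPf ji) ki kj big1; first ring.
  by move=> u /andP[/negPf -> /negPf ->].
exists p', z'; split=> //; last by rewrite loadi loadj !ltrDl.
- by move=> k; rewrite /p'; case: eqP => _; [|case: eqP => _]; rewrite ?p0 //; lra.
- split=> [|k /negPf ki /negPf kj]; last by rewrite /p' ki kj.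
  rewrite (bigD1 i) //= (bigD1 j) //= /p' eqxx (negPf ji) eqxx.
  rewrite (eq_bigr p); first by rewrite -/q sE; ring.
  by move=> u /andP[/negPf -> /negPf ->].
clear loadi loadj loadu.
have a0 : 0 < a by lra.
have qs : e * q <= e * s by rewrite ler_pM2l //; lra.
have rhoS : rho <= 4 * (e * s) by lra.
have es : e * p i <= e * s by rewrite ler_pM2l //; lra.
have ee : e ^+ 2 <= e * p j by rewrite expr2 ler_pM2l //; lra.
have ees : e ^+ 2 <= e * s by have : e * p j <= e * p i by [rewrite ler_pM2l]; lra.
have es0 : 0 < a * (e * s) by rewrite !mulr_gt0 //; lra.
have aes : a * (e * p i) <= a * (e * s) by rewrite ler_pM2l.
have aees : a * e ^+ 2 <= a * (e * s) by rewrite ler_pM2l.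
have aee : a * e ^+ 2 <= a * (e * p j) by rewrite ler_pM2l.
have aep : 0 < a * (e * p j) by rewrite !mulr_gt0.
have eu w : 4 * (e * p w) <= 2 * (p j * p w).
  by have : e * p w <= p j / 2 * p w by [exact: ler_wpM2r]; lra.
have ze : 0 <= z j i + x.
  by move: e2; rewrite /x /al /K; lra.
have ye : 0 <= y by rewrite /y /be; lra.
clear qs rhoS es ee ees es0 aes aees aee aep e1 e2 K0 rho4 sE q0.
split=> u v.
- have zuv := z0 u v.
  have ew w : 0 <= e * p w by rewrite mulr_ge0 // ltW.
  rewrite /z' /d; have [ui|ui] := eqVneq u i.
    have [vi|vi] := eqVneq v i.
      rewrite ui vi zdiag (_ : _ + _ = a * (p i + e) ^+ 2); last by rewrite /al; ring.
      by rewrite mulr_ge0 ?sqr_ge0 // ltW.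
    by have [vj|vj] := eqVneq v j; rewrite addr_ge0 // subr_ge0.
  have [uj|uj] := eqVneq u j.
    have [vi|vi] := eqVneq v i; first by rewrite uj vi.
    have [vj|vj] := eqVneq v j.
      rewrite uj vj zdiag (_ : _ + _ = a * (p j - e) ^+ 2); last by rewrite /be; ring.
      by rewrite mulr_ge0 ?sqr_ge0 // ltW.
    rewrite uj /r; case: (lerP (2 * (p j * p v)) (z v j)) => [_|lt_z].
      by rewrite subrr addr0.
    have := zD j v; rewrite /cap eq_sym (negPf vj).
    by have := eu v; lra.
  case: ifP => _; first by rewrite addr_ge0.
  case: eqVneq => [vj|_]; last by rewrite addr0.
  rewrite vj /r; case: (lerP (2 * (p j * p u)) (z u j)) => [le_z|_]; last first.
    by rewrite subr0 z0.
  by rewrite subr_ge0 (le_trans (eu u)).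
- have := zD u v; rewrite /z' /d /cap /p'.
  have [ui|ui] := eqVneq u i; have [vi|vi] := eqVneq v i.
  + rewrite ui vi eqxx /al; lra.
  + have [vj|vj] := eqVneq v j.
      rewrite ui vj (negPf ij) /x /y /al /be /de; lra.
    rewrite ui eq_sym (negPf vi); lra.
  + have [uj|uj] := eqVneq u j.
      rewrite uj vi (negPf ji) /x /y /al /be /de; lra.
    rewrite vi (negPf ui); lra.
  have [uj|uj] := eqVneq u j; have [vj|vj] := eqVneq v j.
  + rewrite uj vj eqxx /be; lra.
  + rewrite uj eq_sym (negPf vj); lra.
  + rewrite vj (negPf uj); lra.
  by rewrite !addr0.
Qed.

Lemma maximizer_owner (R : realType) (a : R) (T : finType) (b : T -> R)
    (s : R) (p : T -> R) (z : T -> T -> R) (i j : T) :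
  2 < a -> maximizer a b s p z -> (forall k, 0 < p k -> s <= b k) ->
  i != j -> 0 < p j -> p j <= p i -> z j i = 0.
Proof.
move=> a2 [[pb ps zS] zmax] sb ij pj0 le_ji; have z0 := zS.1.
apply/eqP; rewrite eq_le z0 andbT leNgt; apply/negP => zji.
have pi0 : 0 < p i by apply: lt_le_trans le_ji.
have p0 k : 0 <= p k by have /andP[] := pb k.
have [p' [z' [p'0 [p's p'E] zS' loadE [li lj]]]] :=
  tilt a2 p0 zS ij pj0 le_ji zji.
rewrite ps in p's.
have p'le k : p' k <= s.
  by rewrite -p's (bigD1 k) //= lerDl sumr_ge0.
have /zmax : feasible a b s p' z'.
  split=> // k; rewrite p'0 /=.
  have [->|ki] := eqVneq k i; first exact: le_trans (sb i pi0).
  have [->|kj] := eqVneq k j; first exact: le_trans (sb j pj0).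
  by rewrite p'E //; have /andP[] := pb k.
apply/negP; rewrite -ltNge; apply: (root_sum_lt ij loadE).
apply: ltrD; rewrite ltr_sqrt //.
  exact: le_lt_trans (load_ge0 i z0) li.
exact: le_lt_trans (load_ge0 j z0) lj.
Qed.

(** * Deleting a vertex *)

Lemma splits_eq0 (R : realType) (a : R) (T : finType) (p : T -> R)
    (z : T -> T -> R) (u v : T) :
  splits a p z -> p u * p v = 0 -> z u v = 0.
Proof.
move=> [z0 zD] puv; have := zD u v; rewrite /cap puv mulr0.
by have := z0 u v; have := z0 v u; lra.
Qed.

Lemma root_sum_eq0 (R : realType) (a : R) (T : finType) (p : T -> R)
    (z : T -> T -> R) :
  splits a p z -> (forall v, p v = 0) -> root_sum z = 0.
Proof.
move=> zS p0; apply: big1 => v _; rewrite /load big1 ?sqrtr0 // => u _.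
by apply: (splits_eq0 zS); rewrite p0 mul0r.
Qed.

(** A vertex owning all its edges contributes one explicit root, and the other
    loads do not see it. *)
Lemma split_off (R : realType) (a : R) (T : finType) (p : T -> R)
    (z : T -> T -> R) (v : T) :
  splits a p z -> (forall u, u != v -> z v u = 0) ->
  exists2 z', splits a (fun u => if u == v then 0 else p u) z' &
    root_sum z = root_sum z' +
      Num.sqrt (a * p v ^+ 2 + 4 * (p v * (\sum_u p u - p v))).
Proof.
move=> zS zv; have [z0 zD] := zS.
pose z' u w := if (u == v) || (w == v) then 0 else z u w.
exists z'.
  split=> [u w|u w]; first by rewrite /z'; case: ifP.
  rewrite /z' /cap; have [->|uv] /= := eqVneq u v.
    by rewrite orbT mul0r mulr0 addr0.
  by have [_|wv] /= := eqVneq w v; rewrite ?mulr0 ?addr0 ?zD.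
rewrite /root_sum (bigD1 v) //= addrC; congr (_ + Num.sqrt _).
  have load0 : load z' v = 0 by apply: big1 => u _; rewrite /z' eqxx orbT.
  rewrite [RHS](bigD1 v) //= load0 sqrtr0 add0r.
  apply: eq_bigr => w wv; congr Num.sqrt; apply: eq_bigr => u _.
  rewrite /z' (negPf wv) orbF; case: eqP => [->|//].
  exact: zv.
rewrite /load (bigD1 v) //= (splits_diag v zS) (bigD1 (F := p) v) //=.
congr (_ + _).
rewrite addrAC subrr add0r !mulr_sumr; apply: eq_bigr => u uv.
have := zD v u; rewrite (zv _ uv) /cap eq_sym (negPf uv); lra.
Qed.

(** * The scalar recursion *)

(** The value of [gamma n.+1 a] for [2 < a], with the index shifted so that the
    recursion starts at [0]. *)
Fixpoint gamma_rec (R : realType) (a : R) (n : nat) : R :=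
  if n is n.+1 then
    gamma_rec a n + 2 / (gamma_rec a n + Num.sqrt (gamma_rec a n ^+ 2 + 4 - a))
  else Num.sqrt a.

(** With [r = Num.sqrt (g ^+ 2 + 4 - a)] and [h = 2 / (g + r)], the difference
    between the square of [g * q + h * s] and the radicand is
    [(r * q - h * s) ^+ 2]. *)
Lemma step_upper (R : realType) (a g q s : R) :
  0 < g -> a <= g ^+ 2 -> 0 <= q <= s ->
  g * (s - q) + Num.sqrt (a * q ^+ 2 + 4 * (q * (s - q)))
    <= (g + 2 / (g + Num.sqrt (g ^+ 2 + 4 - a))) * s.
Proof.
move=> g0 ag /andP[q0 qs]; set r := Num.sqrt (g ^+ 2 + 4 - a).
have r0 : 0 < r by rewrite sqrtr_gt0; lra.
have r2 : r ^+ 2 = g ^+ 2 + 4 - a by rewrite sqr_sqrtr //; lra.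
set h := 2 / _.
have h0 : 0 < h by rewrite divr_gt0 // addr_gt0.
have hE : h * (g + r) = 2 by rewrite /h divfK // gt_eqF // addr_gt0.
suff : Num.sqrt (a * q ^+ 2 + 4 * (q * (s - q))) <= g * q + h * s by lra.
apply: sqrt_le_sqr; first by rewrite addr_ge0 // mulr_ge0 //; lra.
have -> : (g * q + h * s) ^+ 2
    = a * q ^+ 2 + 4 * (q * (s - q)) + (r * q - h * s) ^+ 2.
  have -> : a = g ^+ 2 + 4 - r ^+ 2 by lra.
  have -> : 4 = 2 * (h * (g + r)) :> R by rewrite hE; lra.
  ring.
by rewrite lerDl sqr_ge0.
Qed.

(** Equality in [step_upper] for [s = 1]: the square vanishes at [q = h / r],
    which is below [1] because [r] is at least [2]. *)
Lemma step_attained (R : realType) (a g : R) :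
  0 < g -> a <= g ^+ 2 ->
  exists2 q, 0 <= q < 1 &
    g * (1 - q) + Num.sqrt (a * q ^+ 2 + 4 * (q * (1 - q)))
      = g + 2 / (g + Num.sqrt (g ^+ 2 + 4 - a)).
Proof.
move=> g0 ag; set r := Num.sqrt (g ^+ 2 + 4 - a).
have r0 : 0 < r by rewrite sqrtr_gt0; lra.
have r2 : r ^+ 2 = g ^+ 2 + 4 - a by rewrite sqr_sqrtr //; lra.
have r_ge2 : 2 <= r.
  by rewrite -(@ler_pXn2r _ 2) ?nnegrE ?(ltW r0) // r2; lra.
set h := 2 / _.
have h0 : 0 < h by rewrite divr_gt0 // addr_gt0.
have hE : h * (g + r) = 2 by rewrite /h divfK // gt_eqF // addr_gt0.
exists (h / r).
  rewrite divr_ge0 ?(ltW h0) ?(ltW r0) //= ltr_pdivrMr // mul1r.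
  rewrite -(@ltr_pM2r _ (g + r)) ?addr_gt0 // hE.
  by have : 0 < r * g by [rewrite mulr_gt0]; nra.
set q := h / r.
have qE : r * q = h by rewrite /q mulrC divfK // gt_eqF.
have -> : a * q ^+ 2 + 4 * (q * (1 - q)) = (g * q + h) ^+ 2.
  have -> : a = g ^+ 2 + 4 - r ^+ 2 by lra.
  have -> : 4 = 2 * (h * (g + r)) :> R by rewrite hE; lra.
  by rewrite -qE; ring.
have q0 : 0 < q by rewrite divr_gt0.
rewrite sqrtr_sqr ger0_norm; first by ring.
have gq0 : 0 < g * q by rewrite mulr_gt0.
lra.
Qed.

Lemma gamma_rec_bounds (R : realType) (a : R) (n : nat) :
  0 < a -> 0 < gamma_rec a n /\ a <= gamma_rec a n ^+ 2.
Proof.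
move=> a0; elim: n => [|n [g0 ag]] /=.
  by rewrite sqrtr_gt0 sqr_sqrtr // ltW.
set h := 2 / _.
have h0 : 0 <= h by rewrite divr_ge0 // addr_ge0 ?sqrtr_ge0 // ltW.
by split; nra.
Qed.

(** * Upper bound for the root sum *)

(** Induction on the number of vertices of positive weight.  At a maximizer
    whose support is within that of [p], the lightest vertex owns all its edges
    ([maximizer_owner]); it is split off, and [step_upper] bounds what
    remains. *)
Lemma root_sum_le_gamma_rec (R : realType) (a : R) (T : finType) (n : nat)
    (p : T -> R) (z : T -> T -> R) :
  2 < a -> (forall v, 0 <= p v) -> splits a p z ->
  (#|[set v | (0 < p v)%R]%SET| <= n.+1)%N ->
  root_sum z <= gamma_rec a n * \sum_v p v.
Proof.
move=> a2; elim: n p z => [|n IHn] p z p0 zS suppn.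
  have [[v pv]|p_eq0] := pselect (exists v, 0 < p v); last first.
    have pE v : p v = 0.
      apply/eqP; rewrite eq_le p0 andbT leNgt; apply/negP => pv.
      by apply: p_eq0; exists v.
    by rewrite (root_sum_eq0 zS pE) big1 ?mulr0.
  have pE u : u != v -> p u = 0.
    move=> uv; apply/eqP; rewrite eq_le p0 andbT leNgt; apply/negP => pu.
    move: suppn; rewrite leqNgt => /negP; apply.
    by apply/card_gt1P; exists u, v; rewrite !inE pu pv.
  have [u uv|z' zS' ->] := split_off (v := v) zS.
    by apply: (splits_eq0 zS); rewrite (pE u uv) mulr0.
  rewrite (root_sum_eq0 zS') => [|u]; last by case: eqP => // /eqP /pE.
  have -> : \sum_u p u = p v by rewrite (bigD1 v) //= big1 ?addr0.
  rewrite subrr !mulr0 addr0 add0r sqrtrM; last by lra.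
  by rewrite sqrtr_sqr ger0_norm.
set s := \sum_v p v.
have s0 : 0 <= s by apply: sumr_ge0.
have [s_eq0|s_neq0] := eqVneq s 0.
  rewrite s_eq0 mulr0 (root_sum_eq0 zS) // => v.
  have p0' u : true -> 0 <= p u by [].
  by rewrite (psumr_eq0P p0' s_eq0).
have s_gt0 : 0 < s by rewrite lt_neqAle eq_sym s_neq0.
pose b v := if 0 < p v then s else 0.
have Fpz : feasible a b s p z.
  split=> // v; rewrite p0 /b; case: ltP => // pv.
  by rewrite /s (bigD1 v) //= lerDl sumr_ge0.
have a0 : 0 <= a by lra.
have [p1 [z1 M1]] := exists_maximizer a0 (ex_intro _ p (ex_intro _ z Fpz)).
have [[pb ps zS1] zmax] := M1.
apply: (le_trans (zmax _ _ Fpz)).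
have p10 v : 0 <= p1 v by have /andP[] := pb v.
have supp1 v : 0 < p1 v -> 0 < p v.
  move=> pv; have := pb v; rewrite /b; case: ifP => // _ /andP[_].
  by rewrite leNgt pv.
have sb v : 0 < p1 v -> s <= b v by move=> /supp1; rewrite /b => ->.
pose A := [set v | 0 < p1 v]%SET.
have [v0 v0A] : exists v, v \in A.
  have [//|nA] := pselect (exists v, v \in A).
  have := s_gt0; rewrite -ps big1 ?ltxx // => v _.
  apply/eqP; rewrite eq_le p10 andbT leNgt; apply/negP => pv.
  by apply: nA; exists v; rewrite inE.
have [v vA vmin] : exists2 v, v \in A & {in A, forall u, p1 v <= p1 u}.
  by have [v vA vmin] := arg_minP p1 v0A; exists v.
have pv : 0 < p1 v by move: vA; rewrite inE.
have zv u : u != v -> z1 v u = 0.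
  move=> uv; have [pu|pu] := ltrP 0 (p1 u); last first.
    apply: (splits_eq0 zS1).
    by have -> : p1 u = 0; [apply/eqP; rewrite eq_le pu p10 | rewrite mulr0].
  by apply: (maximizer_owner a2 M1 sb uv pv); apply: vmin; rewrite inE.
have [z2 zS2 ->] := split_off zS1 zv.
set p2 := fun u => _ in zS2.
have p2s : \sum_u p2 u = s - p1 v.
  rewrite -ps [in RHS](bigD1 v) //= addrAC subrr add0r (bigD1 v) //=.
  rewrite /p2 eqxx add0r; apply: eq_bigr => u.
  by move=> /negPf ->.
have p20 u : 0 <= p2 u by rewrite /p2; case: ifP.
have supp2 : (#|[set u | (0 < p2 u)%R]%SET| <= n.+1)%N.
  rewrite -ltnS; apply: leq_trans suppn; apply: proper_card.
  apply/properP; split; last first.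
    by exists v; rewrite !inE ?supp1 // /p2 eqxx ltxx.
  apply/fintype.subsetP => u; rewrite !inE /p2; case: ifP; rewrite ?ltxx // => _.
  exact: supp1.
have a_gt0 : 0 < a by lra.
have [g0 ag] := gamma_rec_bounds n a_gt0.
have := IHn p2 z2 p20 zS2 supp2; rewrite p2s => le_g.
have ps1 : 0 <= p1 v <= s by rewrite p10 -ps (bigD1 v) //= lerDl sumr_ge0.
apply: le_trans (step_upper g0 ag ps1).
by rewrite ps lerD2r.
Qed.

(** * From matrices to splittings *)

Definition qform (R : realType) (m : nat) (B : 'M[R]_m) (x : 'I_m -> R) : R :=
  \sum_u \sum_v B u v * (x u * x v).

Definition mass (R : realType) (a : R) (m : nat) (B : 'M[R]_m)
    (u v : 'I_m) : R :=
  (if u == v then 2 / a else 1) * B u v ^+ 2.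

Lemma sum_symmetric (R : realType) (m : nat) (U : {set 'I_m})
    (F : 'I_m -> 'I_m -> R) :
  (forall i j, F i j = F j i) ->
  \sum_(i in U) \sum_(j in U) F i j
    = \sum_(i in U) F i i + 2 * \sum_(i in U) \sum_(j in U | (j < i)%N) F i j.
Proof.
move=> Fsym.
have split_i i : i \in U -> \sum_(j in U) F i j = F i i
    + \sum_(j in U | (j < i)%N) F i j + \sum_(j in U | (i < j)%N) F i j.
  move=> iU; rewrite (bigD1 i) //= -addrA; congr (_ + _).
  rewrite (bigID (fun j : 'I_m => (j < i)%N)) /=; congr (_ + _).
    apply: eq_bigl => j; rewrite -val_eqE /=.
    by case: ltngtP => // h; rewrite ?andbF ?andbT.
  apply: eq_bigl => j; rewrite -val_eqE /=.
  by case: ltngtP => // h; rewrite ?andbF ?andbT.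
rewrite (eq_bigr _ split_i) !big_split /= -addrA; congr (_ + _).
rewrite mulr2n mulrDl !mul1r; congr (_ + _).
rewrite (exchange_big_dep (mem U)) /= => [|i j _ /andP[]//].
apply: eq_bigr => j jU; apply: eq_big => [i|i _]; last exact: Fsym.
by rewrite jU.
Qed.

Lemma calI_mass (R : realType) (a : R) (m : nat) (B : 'M[R]_m)
    (U : {set 'I_m}) :
  B = B^T ->
  \sum_(u in U) \sum_(v in U) mass a B u v = 2 * calI U a B.
Proof.
move=> BT.
have Bsym u v : B u v = B v u by rewrite {1}BT mxE.
rewrite sum_symmetric => [|u v]; last by rewrite /mass eq_sym Bsym.
rewrite /calI mulrDr; congr (_ + 2 * _).
  rewrite mulrA mulr_sumr; apply: eq_bigr => u _.
  by rewrite /mass eqxx.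
rewrite [RHS](exchange_big_dep (mem U)) /= => [|i j _ /andP[]//].
apply: eq_bigr => j jU; apply: eq_big => [i|i /andP[_ ij]]; first by rewrite jU.
rewrite /mass Bsym (_ : (j == i) = false) ?mul1r //.
by apply/eqP => ji; rewrite ji ltnn in ij.
Qed.

Lemma calK_mass (R : realType) (a : R) (m : nat) (B : 'M[R]_m) :
  calK a B <-> B = B^T /\ forall U : {set 'I_m},
    \sum_(u in U) \sum_(v in U) mass a B u v <= 2 * #|U|%:R.
Proof.
split=> -[BT h]; split=> // U; last first.
  by move=> _; have := h U; rewrite calI_mass // ler_pM2l.
rewrite calI_mass // ler_pM2l //.
have [->|] := eqVneq U finset.set0; last exact: h.
by rewrite cards0 /calI !big_set0 mulr0 addr0.
Qed.

(** Layer-cake summation: lowering [m] on its support by its smallest positive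
    value subtracts the constraint for this support, and the claim follows by
    induction on the size of the support. *)
Lemma sum_min_le (R : realType) (T : finType) (W : T -> T -> R) (m : T -> R) :
  (forall U : {set T}, \sum_(u in U) \sum_(v in U) W u v <= 2 * #|U|%:R) ->
  (forall v, 0 <= m v) ->
  \sum_u \sum_v Num.min (m u) (m v) * W u v <= 2 * \sum_v m v.
Proof.
move=> WU; have [n] := ubnP #|[set v | (0 < m v)%R]%SET|.
elim: n m => // n IHn m; rewrite ltnS => suppm m0.
set U := [set v | 0 < m v]%SET in suppm.
have mE v : v \notin U -> m v = 0.
  by rewrite inE -leNgt => mv; apply/eqP; rewrite eq_le mv m0.
have [v0 v0U|U0] := pickP (mem U); last first.
  have {}mE v : m v = 0 by apply: mE; rewrite [_ \in _]U0.
  rewrite [X in _ <= _ * X]big1 // mulr0 big1 // => u _; apply: big1 => v _.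
  by rewrite !mE minxx mul0r.
have [w wU wmin] : exists2 w, w \in U & {in U, forall v, m w <= m v}.
  by have [w wU wmin] := arg_minP m v0U; exists w.
pose m' v := if v \in U then m v - m w else m v.
have mw : 0 < m w by move: wU; rewrite inE.
have m'0 v : 0 <= m' v.
  by rewrite /m'; case: ifP => // vU; rewrite subr_ge0 wmin.
have supp' : (#|[set v | (0 < m' v)%R]%SET| < n)%N.
  apply: leq_trans suppm; apply: proper_card; apply/properP; split.
    apply/fintype.subsetP => v; rewrite !inE /m'; case: ifP; rewrite inE //.
  by exists w => //; rewrite inE /m' wU subrr ltxx.
have minE u v : Num.min (m u) (m v)
    = Num.min (m' u) (m' v) + (if (u \in U) && (v \in U) then m w else 0).
  rewrite /m'; case: (boolP (u \in U)) => uU; case: (boolP (v \in U)) => vU /=.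
  - by rewrite addr_minl !subrK.
  - have le_mu : m w <= m u by apply: wmin.
    rewrite (mE _ vU) addr0 !min_r //; lra.
  - have le_mv : m w <= m v by apply: wmin.
    rewrite (mE _ uU) addr0 !min_l //; lra.
  - by rewrite addr0.
have -> : \sum_u \sum_v Num.min (m u) (m v) * W u v
    = \sum_u \sum_v Num.min (m' u) (m' v) * W u v
      + m w * \sum_(u in U) \sum_(v in U) W u v.
  rewrite mulr_sumr [X in _ = _ + X]big_mkcond -big_split /=.
  apply: eq_bigr => u _; case: ifP => uU; last first.
    rewrite addr0; apply: eq_bigr => v _; rewrite minE uU addr0 //.
  rewrite mulr_sumr [X in _ = _ + X]big_mkcond -big_split /=.
  apply: eq_bigr => v _; rewrite minE uU /= mulrDl.
  by case: ifP; rewrite ?mul0r.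
have -> : \sum_v m v = \sum_v m' v + m w * #|U|%:R.
  rewrite -sum1_card natr_sum mulr_sumr [X in _ = _ + X]big_mkcond -big_split /=.
  by apply: eq_bigr => v _; rewrite /m'; case: ifP; rewrite ?addr0 ?mulr1 ?subrK.
by rewrite mulrDr lerD ?IHn // mulrCA ler_pM2l.
Qed.

(** Weighted inequality of arithmetic and geometric means: the difference is a
    square divided by a positive number. *)
Lemma entry_le (R : realType) (a : R) (m : nat) (B : 'M[R]_m) (x : 'I_m -> R)
    (M : R) (u v : 'I_m) :
  0 < a -> 0 < M ->
  B u v * (x u * x v)
    <= (cap a (fun i => x i ^+ 2) u v / M + M * mass a B u v) / 4.
Proof.
move=> a0 M0; rewrite ler_pdivlMr // -subr_ge0 /cap /mass.
case: eqVneq => [->|_].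
  have -> : 2 * a * (x v ^+ 2 * x v ^+ 2) / M + M * (2 / a * B v v ^+ 2)
      - B v v * (x v * x v) * 4 = 2 * (a * x v ^+ 2 - M * B v v) ^+ 2 / (a * M).
    by field; rewrite !gt_eqF.
  by apply: divr_ge0; apply: mulr_ge0; rewrite ?sqr_ge0 // ltW.
have -> : 4 * (x u ^+ 2 * x v ^+ 2) / M + M * (1 * B u v ^+ 2)
    - B u v * (x u * x v) * 4 = (2 * (x u * x v) - M * B u v) ^+ 2 / M.
  by field; rewrite gt_eqF.
by rewrite divr_ge0 ?sqr_ge0 ?(ltW M0).
Qed.

(** Weak duality, with the splitting [z] that maximizes [root_sum] for the
    given weights.  Apply [entry_le] to each entry with [M] the smaller of the
    roots of the two loads.  An end with a share in an edge has the smaller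
    load ([maximizer_load_le]), so the capacity terms add up to twice
    [root_sum z]; the mass terms do not exceed it, by [sum_min_le]. *)
Lemma qform_le_root_sum (R : realType) (a : R) (m : nat) (B : 'M[R]_m)
    (x : 'I_m -> R) :
  0 < a -> calK a B ->
  exists2 z, splits a (fun i => x i ^+ 2) z & qform B x <= root_sum z.
Proof.
move=> a0 /calK_mass[_ WU].
set p := fun i => x i ^+ 2.
have p0 v : 0 <= p v by apply: sqr_ge0.
have cap0 u v : 0 <= cap a p u v.
  by apply: mulr_ge0; [case: ifP => _; lra | exact: mulr_ge0].
have Fp : feasible a p (\sum_v p v) p (fun u v => cap a p u v / 2).
  split=> [i|//|]; [by rewrite p0 lexx|split=> u v].
    by rewrite divr_ge0.
  have -> : cap a p v u = cap a p u v by rewrite /cap eq_sym [p v * _]mulrC.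
  by field.
have [p1 [z M1]] := exists_maximizer (ltW a0) (ex_intro _ p (ex_intro _ _ Fp)).
have [[pb ps zS] _] := M1.
have p1E : p1 = p.
  apply/funext => v; apply/eqP; rewrite eq_sym -subr_eq0; apply/eqP.
  have dge u : true -> 0 <= p u - p1 u by have /andP[_] := pb u; rewrite subr_ge0.
  apply: (psumr_eq0P dge) => //.
  by rewrite sumrB ps subrr.
rewrite p1E in M1 zS; exists z => //.
have [z0 zD] := zS.
pose d v := Num.sqrt (load z v).
have d0 v : 0 <= d v by apply: sqrtr_ge0.
pose M u v := Num.min (d u) (d v).
have dP v : 0 < p v -> 0 < d v.
  move=> pv; rewrite sqrtr_gt0; apply: lt_le_trans (_ : z v v <= _).
    by rewrite (splits_diag v zS) mulr_gt0 // exprn_gt0.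
  by rewrite /load (bigD1 v) //= lerDl sumr_ge0.
have le1 u v : B u v * (x u * x v)
    <= (cap a p u v / M u v + M u v * mass a B u v) / 4.
  have [pu|pu] := eqVneq (p u) 0.
    have xu : x u = 0 by apply/eqP; rewrite -sqrf_eq0; apply/eqP.
    rewrite xu mul0r mulr0 /cap pu mul0r mulr0 mul0r add0r.
    rewrite divr_ge0 // mulr_ge0 ?le_min ?d0 // mulr_ge0 ?sqr_ge0 //.
    by case: ifP => _; rewrite ?divr_ge0 // ltW.
  have [pv|pv] := eqVneq (p v) 0.
    have xv : x v = 0 by apply/eqP; rewrite -sqrf_eq0; apply/eqP.
    rewrite xv !mulr0 /cap pv !mulr0 mul0r add0r.
    rewrite divr_ge0 // mulr_ge0 ?le_min ?d0 // mulr_ge0 ?sqr_ge0 //.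
    by case: ifP => _; rewrite ?divr_ge0 // ltW.
  apply: entry_le => //.
  by rewrite lt_min !dP // lt_neqAle eq_sym ?pu ?pv p0.
have le_d u v : z u v / M u v = z u v / d v.
  have [->|zuv] := eqVneq (z u v) 0; first by rewrite !mul0r.
  rewrite /M min_r // ler_wsqrtr //; apply: (maximizer_load_le M1).
  by rewrite lt_neqAle eq_sym zuv z0.
have sum_cap : \sum_u \sum_v cap a p u v / M u v = 2 * root_sum z.
  have -> : \sum_u \sum_v cap a p u v / M u v
      = \sum_u \sum_v z u v / d v + \sum_u \sum_v z v u / d u.
    rewrite -big_split; apply: eq_bigr => u _; rewrite -big_split.
    by apply: eq_bigr => v _; rewrite /= -le_d -(le_d v u) /M minC -zD mulrDl.
  have E : \sum_u \sum_v z v u / d u = root_sum z.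
    apply: eq_bigr => v _; rewrite -mulr_suml -/(load z v) /d.
    have := sqr_sqrtr (load_ge0 v z0); set r := Num.sqrt _ => <-.
    have [->|r0] := eqVneq r 0; first by rewrite expr0n mul0r.
    by rewrite expr2 mulfK.
  by rewrite exchange_big /= E; lra.
have sum_mass : \sum_u \sum_v M u v * mass a B u v <= 2 * root_sum z.
  exact: sum_min_le.
have : qform B x <= \sum_u \sum_v
    (cap a p u v / M u v + M u v * mass a B u v) / 4.
  by apply: ler_sum => u _; apply: ler_sum.
have -> : \sum_u \sum_v (cap a p u v / M u v + M u v * mass a B u v) / 4
    = (\sum_u \sum_v cap a p u v / M u v
       + \sum_u \sum_v M u v * mass a B u v) / 4.
  rewrite -big_split mulr_suml; apply: eq_bigr => u _.
  by rewrite -big_split mulr_suml.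
rewrite sum_cap; lra.
Qed.

(** * Eigenvalues and quadratic forms *)

Lemma qform_row (R : realType) (m : nat) (B : 'M[R]_m) (v : 'rV[R]_m)
    (y : 'I_m -> R) :
  \sum_i \sum_j B i j * (v 0 i * y j) = \sum_j (v *m B) 0 j * y j.
Proof.
rewrite exchange_big; apply: eq_bigr => j _.
by rewrite mxE mulr_suml; apply: eq_bigr => i _; ring.
Qed.

Lemma eigen_le (R : realType) (m : nat) (B : 'M[R]_m) (g l : R) :
  (forall x, qform B x <= g * \sum_i x i ^+ 2) -> eigenvalue B l -> l <= g.
Proof.
move=> qg /eigenvalueP[v vB v0].
have n0 : 0 < \sum_i v 0 i ^+ 2.
  rewrite lt_neqAle sumr_ge0 => [|i _]; last exact: sqr_ge0.
  rewrite andbT eq_sym; apply: contraNneq v0 => n0.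
  apply/eqP/rowP => i; rewrite mxE; apply/eqP; rewrite -sqrf_eq0; apply/eqP.
  by apply: (psumr_eq0P _ n0) => // j _; exact: sqr_ge0.
have := qg (v 0); rewrite /qform qform_row vB.
rewrite (eq_bigr (fun i => l * v 0 i ^+ 2)) => [|i _]; last by rewrite mxE; ring.
by rewrite -mulr_sumr ler_pM2r.
Qed.

(** The form of [g - B] is nonnegative and vanishes at [x].  Moving from [x] in
    the direction [y = (g - B) x] changes it by
    [2 * s * n + s ^+ 2 * d] where [n] is the squared norm of [y]; small
    negative [s] force [n = 0]. *)
Lemma eigenvalue_of_max (R : realType) (m : nat) (B : 'M[R]_m) (g : R)
    (x : 'I_m -> R) :
  B = B^T -> (forall y, qform B y <= g * \sum_i y i ^+ 2) ->
  0 < \sum_i x i ^+ 2 -> qform B x = g * \sum_i x i ^+ 2 -> eigenvalue B g.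
Proof.
move=> BT qg nx qx.
have Bsym u v : B u v = B v u by rewrite {1}BT mxE.
pose v : 'rV[R]_m := \row_i x i.
have vE i : v 0 i = x i by rewrite mxE.
pose y i := g * x i - (v *m B) 0 i.
set n := \sum_i y i ^+ 2.
have n0 : 0 <= n by apply: sumr_ge0 => i _; exact: sqr_ge0.
pose d := g * n - qform B y.
have d0 : 0 <= d by rewrite subr_ge0; exact: qg.
have cross : g * \sum_i x i * y i - \sum_i \sum_j B i j * (x i * y j) = n.
  have -> : \sum_i \sum_j B i j * (x i * y j) = \sum_j (v *m B) 0 j * y j.
    by rewrite -qform_row; do 2!apply: eq_bigr => ? _; rewrite vE.
  rewrite mulr_sumr -sumrB; apply: eq_bigr => i _; rewrite /y; ring.
have quad s : 0 <= 2 * s * n + s ^+ 2 * d.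
  have := qg (fun i => x i + s * y i).
  have -> : \sum_i (x i + s * y i) ^+ 2 = \sum_i x i ^+ 2
      + (2 * s * \sum_i x i * y i + s ^+ 2 * n).
    rewrite !mulr_sumr -!big_split; apply: eq_bigr => i _ /=; ring.
  have -> : qform B (fun i => x i + s * y i) = qform B x
      + (2 * s * \sum_i \sum_j B i j * (x i * y j) + s ^+ 2 * qform B y).
    have -> : 2 * s * \sum_i \sum_j B i j * (x i * y j)
        = s * \sum_i \sum_j B i j * (x i * y j)
          + s * \sum_i \sum_j B i j * (y i * x j).
      have -> : \sum_i \sum_j B i j * (y i * x j)
          = \sum_i \sum_j B i j * (x i * y j).
        rewrite exchange_big; do 2!apply: eq_bigr => ? _.
        by rewrite Bsym [y _ * _]mulrC.
      ring.
    rewrite /qform !mulr_sumr -!big_split; apply: eq_bigr => i _ /=.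
    rewrite !mulr_sumr -!big_split; apply: eq_bigr => j _ /=; ring.
  rewrite qx -subr_ge0 /d -[X in _ -> _ <= 2 * s * X + _]cross; congr (0 <= _).
  ring.
have n_eq0 : n = 0.
  apply/eqP; rewrite eq_le n0 andbT leNgt; apply/negP => n_gt0.
  (* Small enough for the linear term to win, as [n / (d + 1) * d < n]. *)
  have := quad (- (n / (d + 1))).
  have d1 : 0 < d + 1 by lra.
  set t := n / (d + 1); have tE : n = t * (d + 1) by rewrite /t divfK // gt_eqF.
  have t0 : 0 < t by rewrite divr_gt0.
  rewrite tE; nra.
apply/eigenvalueP; exists v.
  apply/rowP => i; rewrite [RHS]mxE vE.
  have : y i ^+ 2 = 0 by apply: (psumr_eq0P _ n_eq0) => // j _; exact: sqr_ge0.
  by move=> /eqP; rewrite sqrf_eq0 /y subr_eq0 => /eqP ->.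
apply: contraTneq nx => v0; rewrite big1 ?ltxx // => i _.
by rewrite -vE v0 mxE expr0n.
Qed.

(** Eigenvalues are values of the form at unit vectors, so they obey the upper
    bound too.  If [B] had no greatest eigenvalue, [lambda_max B] would be [0],
    whence [0 <= g]. *)
Lemma gamma_eq (R : realType) (m : nat) (a g : R) :
  0 <= g ->
  (forall B : 'M[R]_m, calK a B ->
     forall x, qform B x <= g * \sum_i x i ^+ 2) ->
  (exists2 B : 'M[R]_m, calK a B &
     exists2 x, 0 < \sum_i x i ^+ 2 & qform B x = g * \sum_i x i ^+ 2) ->
  gamma m a = g.
Proof.
move=> g0 qg [B KB [x nx qx]]; apply: setmaxE; split.
  exists B => //; apply: setmaxE; split.
    exact: (eigenvalue_of_max KB.1 (qg B KB) nx qx).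
  by move=> l; exact: (eigen_le (qg B KB)).
move=> _ [C KC <-]; rewrite /lambda_max /setmax.
by case: xgetP => [l _ [Cl _]|//]; exact: (eigen_le (qg C KC) Cl).
Qed.

(** * Extremal matrices *)

(** The load of [i] when each edge belongs to its end of larger index. *)
Definition prefix_load (R : realType) (a : R) (p : nat -> R) (i : nat) : R :=
  a * p i ^+ 2 + 4 * (p i * \sum_(j < i) p j).

(** Each step adds a vertex whose part of the total weight is the optimal [q] of
    [step_attained]; the earlier weights are kept, only the total grows. *)
Lemma exists_weights (R : realType) (a : R) (n : nat) :
  0 < a ->
  exists p : nat -> R, [/\ forall i, 0 <= p i, 0 < \sum_(i < n.+1) p i &
    \sum_(i < n.+1) Num.sqrt (prefix_load a p i)
      = gamma_rec a n * \sum_(i < n.+1) p i].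
Proof.
move=> a0; elim: n => [|n [p [p0 s0 pE]]].
  exists (fun _ => 1); split => //; rewrite ?big_ord_recl ?big_ord0 ?addr0 //.
  by rewrite /prefix_load big_ord0 /= expr1n !mulr0 addr0 !mulr1.
have [g0 ag] := gamma_rec_bounds n a0.
have [q /andP[q0 q1] qE] := step_attained g0 ag.
set s := \sum_(i < n.+1) p i in s0 pE.
pose c := s / (1 - q).
have c0 : 0 < c by rewrite divr_gt0 // subr_gt0.
have cE : s = c * (1 - q) by rewrite /c divfK // subr_eq0 gt_eqF.
pose p' i := if i == n.+1 then c * q else p i.
have pp' (i : 'I_n.+1) : p' i = p i by rewrite /p' ltn_eqF.
have p'n : p' n.+1 = c * q by rewrite /p' eqxx.
have s'E : \sum_(i < n.+1) p' i = s by apply: eq_bigr => i _; rewrite pp'.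
have total : \sum_(i < n.+2) p' i = c.
  by rewrite big_ord_recr /= s'E p'n cE; ring.
exists p'; split; rewrite ?total //.
  by move=> i; rewrite /p'; case: eqP => // _; rewrite mulr_ge0 // ltW.
rewrite big_ord_recr /=.
rewrite (eq_bigr (fun i : 'I_n.+1 => Num.sqrt (prefix_load a p i))).
  rewrite pE -qE /prefix_load p'n s'E {1}cE cE.
  have -> : a * (c * q) ^+ 2 + 4 * (c * q * (c * (1 - q)))
      = c ^+ 2 * (a * q ^+ 2 + 4 * (q * (1 - q))) by ring.
  rewrite sqrtrM ?sqr_ge0 // sqrtr_sqr ger0_norm ?(ltW c0) //; ring.
move=> i _; rewrite /prefix_load pp'; congr (Num.sqrt (_ + _ * (_ * _))).
apply: eq_bigr => j _; rewrite /p' ltn_eqF //.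
exact: ltn_trans (ltn_ord j) (ltn_ord i).
Qed.

Lemma sum_ord_lt (R : realType) (m : nat) (p : nat -> R) (i : 'I_m) :
  \sum_(j < m | (j < i)%N) p j = \sum_(j < i) p j.
Proof. by rewrite (big_ord_widen m) // ltnW. Qed.

(** The mass of an edge is taken proportional to its capacity, with a factor
    making each vertex own one unit of [calI].  An edge inside [U] is owned by
    an element of [U], whence the constraint for [U].  Where [prefix_load]
    vanishes, so does the whole row, since division by zero gives zero. *)
Lemma exists_matrix (R : realType) (a : R) (m : nat) (p : nat -> R) :
  0 < a -> (forall i, 0 <= p i) ->
  exists2 B : 'M[R]_m, calK a B &
    qform B (fun i => Num.sqrt (p i))
      = \sum_(i < m) Num.sqrt (prefix_load a p i).
Proof.
move=> a0 p0.
pose r i := Num.sqrt (prefix_load a p i).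
have load0 i : 0 <= prefix_load a p i.
  by rewrite addr_ge0 // !mulr_ge0 ?sqr_ge0 ?sumr_ge0 // ltW.
pose x (i : nat) := Num.sqrt (p i).
have xx i : x i ^+ 2 = p i by rewrite sqr_sqrtr.
pose B : 'M[R]_m :=
  \matrix_(i, j) ((if i == j then a else 2) * (x i * x j) / r (maxn i j)).
have Bdiag i : B i i = a * p i / r i by rewrite mxE eqxx maxnn -expr2 xx.
have Blt (i j : 'I_m) : (j < i)%N -> B i j = 2 * (x i * x j) / r i.
  move=> ji; rewrite mxE (maxn_idPl (ltnW ji)) (_ : (i == j) = false) //.
  by apply/eqP => ij; rewrite ij ltnn in ji.
have Bsym i j : B i j = B j i by rewrite !mxE eq_sym maxnC [x i * _]mulrC.
exists B.
  apply/calK_mass; split; first by apply/matrixP => i j; rewrite [RHS]mxE Bsym.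
  move=> U; rewrite sum_symmetric; last by move=> i j; rewrite /mass eq_sym Bsym.
  rewrite mulr_sumr -big_split /= -sum1_card natr_sum mulr_sumr.
  apply: ler_sum => i iU; rewrite mulr1 /mass eqxx Bdiag.
  have [r0|r0] := eqVneq (r i) 0.
    rewrite r0 invr0 mulr0 expr0n mulr0 add0r big1 ?mulr0 // => j /andP[_ ji].
    by rewrite Blt // r0 invr0 mulr0 expr0n mulr0.
  have rE : r i ^+ 2 = prefix_load a p i by rewrite sqr_sqrtr.
  have r2 : 0 < r i ^+ 2 by rewrite exprn_gt0 // lt_neqAle eq_sym r0 sqrtr_ge0.
  have -> : 2 / a * (a * p i / r i) ^+ 2 = 2 * (a * p i ^+ 2) / r i ^+ 2.
    by field; rewrite r0 gt_eqF.
  have -> : \sum_(j in U | (j < i)%N) (if i == j then 2 / a else 1) * B i j ^+ 2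
      = 4 * (p i * \sum_(j in U | (j < i)%N) p j) / r i ^+ 2.
    rewrite !mulr_sumr mulr_suml; apply: eq_bigr => j /andP[_ ji].
    rewrite Blt // (_ : (i == j) = false); last first.
      by apply/eqP => ij; rewrite ij ltnn in ji.
    by rewrite -!xx; field.
  rewrite [2 * (_ / _)]mulrA -mulrDl ler_pdivrMr // -mulrDr ler_pM2l //.
  rewrite rE /prefix_load.
  rewrite lerD2l ler_pM2l // ler_wpM2l // -sum_ord_lt.
  rewrite [leRHS](bigID (mem U)) /=.
  rewrite [X in _ <= X + _](eq_bigl (fun j => (j \in U) && (j < i)%N)).
    by rewrite lerDl sumr_ge0.
  by move=> j; rewrite andbC.
rewrite /qform.
have setTE F : \sum_(i : 'I_m) F i = \sum_(i in [set: 'I_m]%SET) F i :> R.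
  by apply: eq_bigl => i; rewrite inE.
rewrite setTE; under eq_bigr do rewrite setTE.
rewrite sum_symmetric => [|i j]; last by rewrite Bsym [_ * Num.sqrt (p j)]mulrC.
rewrite mulr_sumr -big_split /= [RHS]setTE; apply: eq_bigr => i _.
rewrite -/(x i) -expr2 xx Bdiag.
have -> : \sum_(j in [set: 'I_m]%SET | (j < i)%N) B i j * (x i * x j)
    = 2 * (p i * \sum_(j < i) p j) / r i.
  rewrite -sum_ord_lt !mulr_sumr mulr_suml; apply: eq_big => [j|j /andP[_ ji]].
    by rewrite inE.
  by rewrite Blt // -!xx; ring.
have -> : a * p i / r i * p i + 2 * (2 * (p i * \sum_(j < i) p j) / r i)
    = prefix_load a p i / r i by rewrite /prefix_load; ring.
rewrite -/(r i); have [r0|r0] := eqVneq (r i) 0; first by rewrite r0 invr0 mulr0.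
have rE : r i ^+ 2 = prefix_load a p i by rewrite sqr_sqrtr.
by rewrite -rE expr2 mulfK.
Qed.

(** * The values of gamma *)

Lemma gammaE (R : realType) (a : R) (n : nat) :
  2 < a -> gamma n.+1 a = gamma_rec a n.
Proof.
move=> a2; have a0 : 0 < a by lra.
have [g0 ag] := gamma_rec_bounds n a0.
apply: gamma_eq; first exact: ltW.
  move=> B KB x; have [z zS qz] := qform_le_root_sum x a0 KB.
  apply: le_trans qz _; apply: root_sum_le_gamma_rec zS _ => // [v|].
    exact: sqr_ge0.
  by rewrite -[n in (_ <= n)%N]card_ord max_card.
have [p [p0 s0 pE]] := exists_weights n a0.
have [B KB qB] := exists_matrix n.+1 a0 p0; exists B => //.
have sE : \sum_(i < n.+1) Num.sqrt (p i) ^+ 2 = \sum_(i < n.+1) p i.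
  by apply: eq_bigr => i _; rewrite sqr_sqrtr.
by exists (fun i : 'I_n.+1 => Num.sqrt (p i)); rewrite sE // qB.
Qed.

(** [entry_le] with the constant [M = g * P / k] is the Cauchy-Schwarz
    inequality.  The total capacity is [4 * P ^+ 2 + (2 * a - 4) * S] with
    [P ^+ 2 <= k * S], and here the coefficient of [S] is not positive. *)
Lemma gamma_small (R : realType) (a : R) (k : nat) :
  0 < a -> a <= 2 -> (0 < k)%N -> gamma k a = Num.sqrt (a + 2 * (k%:R - 1)).
Proof.
move=> a0 a2 k0.
have k1 : 1 <= k%:R :> R by rewrite ler1n.
set g := Num.sqrt _.
have g2 : g ^+ 2 = a + 2 * (k%:R - 1) by rewrite sqr_sqrtr //; lra.
have g0 : 0 < g by rewrite sqrtr_gt0; lra.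
apply: gamma_eq; first exact: ltW.
  move=> B /calK_mass[_ /(_ finset.setT)] mB x.
  set P := \sum_i x i ^+ 2.
  have P0 : 0 <= P by apply: sumr_ge0 => i _; exact: sqr_ge0.
  have [P_eq0|P_neq0] := eqVneq P 0.
    have x0 i : x i = 0.
      apply/eqP; rewrite -sqrf_eq0; apply/eqP.
      by apply: (psumr_eq0P _ P_eq0) => // j _; exact: sqr_ge0.
    rewrite P_eq0 mulr0 /qform big1 // => i _; apply: big1 => j _.
    by rewrite !x0 !mulr0.
  have P_gt0 : 0 < P by rewrite lt_neqAle eq_sym P_neq0.
  pose M := g * P / k%:R.
  have M0 : 0 < M by rewrite divr_gt0 ?mulr_gt0 //; lra.
  have : qform B x <= \sum_u \sum_v
      (cap a (fun i => x i ^+ 2) u v / M + M * mass a B u v) / 4.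
    by apply: ler_sum => u _; apply: ler_sum => v _; exact: entry_le.
  have -> : \sum_u \sum_v
        (cap a (fun i => x i ^+ 2) u v / M + M * mass a B u v) / 4
      = ((\sum_u \sum_v cap a (fun i => x i ^+ 2) u v) / M
         + M * \sum_u \sum_v mass a B u v) / 4.
    rewrite mulr_sumr !mulr_suml -big_split mulr_suml; apply: eq_bigr => u _.
    by rewrite mulr_sumr !mulr_suml -big_split mulr_suml.
  set Q := \sum_u \sum_v cap _ _ _ _; set W := \sum_u _.
  have WE : W <= 2 * k%:R.
    move: mB; rewrite cardsT card_ord; apply: le_trans.
    by rewrite le_eqVlt; apply/orP; left; apply/eqP; apply: eq_big => [u|u _];
      rewrite ?inE //; apply: eq_bigl => v; rewrite inE.
  set S := \sum_i x i ^+ 4.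
  have QE : Q = 4 * P ^+ 2 + (2 * a - 4) * S.
    have -> : 4 * P ^+ 2 = \sum_u \sum_v 4 * (x u ^+ 2 * x v ^+ 2).
      rewrite expr2 {1}/P mulr_suml mulr_sumr; apply: eq_bigr => u _.
      by rewrite /P !mulr_sumr.
    rewrite mulr_sumr -big_split; apply: eq_bigr => u _ /=.
    rewrite (bigD1 u) //= [in RHS](bigD1 u) //= /cap eqxx.
    rewrite (eq_bigr (fun v => 4 * (x u ^+ 2 * x v ^+ 2))); first by ring.
    by move=> v; rewrite eq_sym => /negPf ->.
  have SE : P ^+ 2 <= k%:R * S.
    have : 0 <= \sum_i (x i ^+ 2 - P / k%:R) ^+ 2.
      by apply: sumr_ge0 => i _; exact: sqr_ge0.
    have -> : \sum_i (x i ^+ 2 - P / k%:R) ^+ 2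
        = S - 2 * (P / k%:R) * P + (P / k%:R) ^+ 2 * k%:R.
      rewrite -[X in _ + _ * X%:R](card_ord k) -sum1_card natr_sum /S /P.
      by rewrite !mulr_sumr -sumrB -big_split; apply: eq_bigr => i _ /=; ring.
    have -> : S - 2 * (P / k%:R) * P + (P / k%:R) ^+ 2 * k%:R
        = (k%:R * S - P ^+ 2) / k%:R by field; rewrite gt_eqF //; lra.
    by rewrite pmulr_lge0 ?invr_gt0 ?subr_ge0 //; lra.
  have QM : Q / M <= 2 * (g * P).
    rewrite ler_pdivrMr // /M.
    have -> : 2 * (g * P) * (g * P / k%:R) = 2 * g ^+ 2 * P ^+ 2 / k%:R by ring.
    rewrite ler_pdivlMr; last by lra.
    rewrite QE g2; nra.
  have MW : M * W <= 2 * (g * P).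
    have -> : 2 * (g * P) = M * (2 * k%:R).
      by rewrite /M; field; rewrite gt_eqF //; lra.
    by rewrite ler_pM2l.
  lra.
(* With all entries of [x] equal, equality in [entry_le] forces this shape. *)
pose B : 'M[R]_k := \matrix_(i, j) ((if i == j then a else 2) / g).
have Bsym i j : B i j = B j i by rewrite !mxE eq_sym.
have sum_ite (U : {set 'I_k}) (c d : R) i : i \in U ->
    \sum_(j in U) (if i == j then c else d) = c + d * (#|U|%:R - 1).
  move=> iU; rewrite (bigD1 i) //= eqxx; congr (_ + _).
  have -> : #|U|%:R - 1 = \sum_(j in U | j != i) 1 :> R.
    by rewrite -sum1_card natr_sum (bigD1 i) //= addrAC subrr add0r.
  rewrite mulr_sumr; apply: eq_bigr => j /andP[_]; rewrite eq_sym => /negPf ->.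
  by rewrite mulr1.
have gN0 : g != 0 by rewrite gt_eqF.
exists B.
  apply/calK_mass; split; first by apply/matrixP => i j; rewrite [RHS]mxE Bsym.
  move=> U; have Uk : #|U|%:R <= k%:R :> R.
    by rewrite ler_nat -[k in (_ <= k)%N]card_ord max_card.
  rewrite -sum1_card natr_sum mulr_sumr; apply: ler_sum => i iU.
  rewrite mulr1 (eq_bigr (fun j => if i == j then 2 * a / g ^+ 2
                                  else 4 / g ^+ 2)).
    rewrite sum_ite //.
    have -> : 2 * a / g ^+ 2 + 4 / g ^+ 2 * (#|U|%:R - 1)
       = 2 * (a + 2 * (#|U|%:R - 1)) / g ^+ 2 by field.
    rewrite ler_pdivrMr ?exprn_gt0 // g2; lra.
  move=> j _; rewrite /mass mxE; case: eqP => _; field; rewrite ?gN0 //.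
  by rewrite gt_eqF.
exists (fun _ => 1).
  by rewrite sumr_const card_ord expr1n; lra.
rewrite /qform mulr_sumr; apply: eq_bigr => i _.
rewrite (eq_bigr (fun j => if i == j then a / g else 2 / g)).
  have sumT := sum_ite finset.setT (a / g) (2 / g) i (finset.in_setT i).
  have -> : \sum_j (if i == j then a / g else 2 / g) = a / g + 2 / g * (k%:R - 1).
    rewrite -[k in k%:R - 1]card_ord -cardsT -sumT.
    by apply: eq_bigl => j; rewrite inE.
  rewrite expr1n mulr1; apply: (mulIf gN0); rewrite -expr2 g2.
  by field.
by move=> j _; rewrite mxE !mulr1; case: ifP.
Qed.

Theorem theorem2 (R : realType) (a : R) (a_gt0 : 0 < a) :
  (a <= 2 ->
     forall k : nat, (1 <= k)%N ->
       gamma k a = Num.sqrt (a + 2 * (k%:R - 1)))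
  /\
  (2 < a ->
     gamma 1 a = Num.sqrt a
     /\ forall k : nat, (2 <= k)%N ->
          gamma k a
            = setmax [set t * gamma k.-1 a
                          + Num.sqrt ((1 - t) * (a * (1 - t) + 4 * t))
                     | t in [set t : R | 0 <= t <= 1]]
          /\ gamma k a
            = gamma k.-1 a
              + 2 / (gamma k.-1 a + Num.sqrt (gamma k.-1 a ^+ 2 + 4 - a))).
Proof.
split=> [a2 k k0|a2]; first exact: gamma_small.
split=> [|[|[|n]]] //; first exact: gammaE.
rewrite /= !gammaE // => _; split=> //.
have [g0 ag] := gamma_rec_bounds n a_gt0.
have termE q : (1 - (1 - q)) * (a * (1 - (1 - q)) + 4 * (1 - q))
    = a * q ^+ 2 + 4 * (q * (1 - q)) by ring.
symmetry; apply: setmaxE; split=> [|_ [t /andP[t0 t1] <-]] /=.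
  have [q /andP[q0 q1] qE] := step_attained g0 ag.
  exists (1 - q); first by rewrite /=; lra.
  by rewrite termE mulrC.
have t'01 : 0 <= 1 - t <= 1 by lra.
have := step_upper g0 ag t'01; rewrite -termE !subKr mulr1.
by rewrite mulrC.
Qed.
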